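(* Let $\alpha\in\mathbb{Q}_p$ have infinite continued fraction expansion $[a_0,a_1,\dots]$ with complete quotients $\alpha_n$, and let $x,y,z,t\in\mathbb{Q}$ with $xt-yz\ne0$ be such that $$v_p(x\alpha+y)\le v_p(x)\quad\text{and}\quad v_p(z\alpha+t)\le v_p(z).$$ Define $(x_0,y_0,z_0,t_0)=(x,y,z,t)$ and $x_{n+1}=x_na_n+y_n$, $y_{n+1}=x_n$, $z_{n+1}=z_na_n+t_n$, $t_{n+1}=z_n$ for $n\ge0$. Then, for all $n\ge1$, $$v_p(x_na_n)<v_p(y_n)\quad\text{and}\quad v_p(z_na_n)<v_p(t_n).$$ Moreover, the quantity $$\left\lfloor\frac{x\alpha+y}{z\alpha+t}\right\rfloor_p=\left\lfloor\frac{x_n\alpha_n+y_n}{z_n\alpha_n+t_n}\right\rfloor_p$$ can be determined at a step $n\ge1$ (from $x_n,y_n,z_n,t_n$ and $a_n$) if and only if $$r_n=-v_p(\alpha_n)\ge v_p(z_1)-v_p(x_1).$$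
   Context: $p$ is a prime, $v_p$ is the $p$-adic valuation on $\mathbb{Q}_p$, with $v_p(0)=+\infty$. Fix a digit set: either $\{0,\dots,p-1\}$ (Ruban) or, for $p$ odd, $\{-\frac{p-1}{2},\dots,\frac{p-1}{2}\}$ (Browkin I). Every nonzero $\alpha\in\mathbb{Q}_p$ is uniquely $\alpha=\sum_{n\ge -r}c_np^n$ with $c_n$ in the digit set, $c_{-r}\neq0$, $v_p(\alpha)=-r$; its first $h$ digits are $c_{-r},\dots,c_{-r+h-1}$, and two numbers have the same first $h\ge 1$ digits if they have the same valuation and these coefficients agree. The floor is $\lfloor\alpha\rfloor_p=\sum_{n=-r}^{0}c_np^n$ (equal to $0$ if $r<0$ or $\alpha=0$). The continued fraction expansion $[a_0,a_1,\dots]$ of $\alpha$ is given by $\alpha_0=\alpha$, $a_n=\lfloor\alpha_n\rfloor_p$, $\alpha_{n+1}=\frac1{\alpha_n-a_n}$. Meaning of ''determined'' at step $n\ge1$: $x_n,y_n,z_n,t_n$ are known exactly, and of $\alpha_n$ only the first $r_n+1$ digits (i.e. $a_n=\lfloor\alpha_n\rfloor_p$) are known. The known digits of $x_n\alpha_n+y_n$ are its first $v_p(x_n)-v_p(x_na_n+y_n)+1$ digits (all if $x_n=0$; none if this number is $\le0$), and the known digits of $z_n\alpha_n+t_n$ are its first $v_p(z_n)-v_p(z_na_n+t_n)+1$ digits (all if $z_n=0$; none if $\le0$). The floor of the quotient can be determined if $\lfloor N/D\rfloor_p$ takes the same value for all nonzero $N,D\in\mathbb{Q}_p$ such that $N$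 agrees with $x_n\alpha_n+y_n$ in all known digits of the latter and $D$ agrees with $z_n\alpha_n+t_n$ in all known digits of the latter. *)

(* Defs.v *)
From HB Require Import structures.
From mathcomp Require Import all_boot all_order all_algebra.
From mathcomp Require Import zify ring.
From mathcomp Require Import generic_quotient fraction boolp classical_sets constructive_ereal.

Set Implicit Arguments.
Unset Strict Implicit.
Unset Printing Implicit Defensive.

Import Order.TTheory GRing.Theory Num.Theory.
Local Open Scope ring_scope.

(* Z_p is the inverse limit of the rings Z/p^n, and Q_p its field of          *)
(* fractions.  Both are indexed by the proof that p is prime.                 *)

(* A coherent sequence of residues: [res n] is the representative in          *)
(* [0, p^n[ of the class modulo p^n.                                          *)
Record padic_int (p : nat) (pp : prime p) := PadicInt {
  res : nat -> int;
  resP : forall n, res n = (res n.+1 %% (p ^ n)%N)%Z }.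

Arguments res {p pp} x n : rename.

Section PadicIntegers.
Variables (p : nat) (pp : prime p).
Local Notation padic_int := (padic_int pp).

HB.instance Definition _ := gen_eqMixin padic_int.
HB.instance Definition _ := gen_choiceMixin padic_int.

Let pn_neq0 n : ((p ^ n)%N : int) != 0.
Proof. by rewrite eqz_nat expn_eq0 negb_and -lt0n prime_gt0. Qed.

Let modz_dvdm x d m : (d %| m)%Z -> ((x %% m)%Z = x %[mod d])%Z.
Proof.
move=> dm; apply/eqP; rewrite eqz_mod_dvd {2}(divz_eq x m).
by rewrite opprD addrCA subrr addr0 -mulNr dvdz_mull.
Qed.

Lemma padic_int_of_proof (f : nat -> int) :
  (forall n, f n = f n.+1 %[mod (p ^ n)%N])%Z ->
  forall n, (f n %% (p ^ n)%N)%Z = ((f n.+1 %% (p ^ n.+1)%N)%Z %% (p ^ n)%N)%Z.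
Proof. by move=> h n; rewrite h modz_dvdm // dvdzE /= dvdn_exp2l. Qed.

Definition padic_int_of f hf : padic_int := PadicInt _ (@padic_int_of_proof f hf).

Lemma res_modz (x : padic_int) m n :
  (m <= n)%N -> res x m = (res x n %% (p ^ m)%N)%Z.
Proof.
move=> /subnK <-; elim: (n - m)%N => [|k IH].
  by rewrite add0n resP modz_mod.
by rewrite IH addSn (resP x (k + m)) modz_dvdm // dvdzE /= dvdn_exp2l ?leq_addl.
Qed.

Lemma res_mod (x : padic_int) n : (res x n %% (p ^ n)%N)%Z = res x n.
Proof. by rewrite -res_modz. Qed.

Lemma res_coh (x : padic_int) n : (res x n = res x n.+1 %[mod (p ^ n)%N])%Z.
Proof. by rewrite res_mod -resP. Qed.

Lemma padic_int_eq (x y : padic_int) :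
  (forall n, res x n = res y n %[mod (p ^ n)%N])%Z -> x = y.
Proof.
move=> h; have e : res x = res y by apply: funext => n; rewrite -res_mod h res_mod.
case: x y e {h} => [f Pf] [g Pg] /= e; case: _ / e Pg => Pg.
by congr PadicInt; exact: Prop_irrelevance.
Qed.

Definition padic_int0 : padic_int :=
  padic_int_of (f := fun=> 0) (fun=> erefl).
Definition padic_int1 : padic_int :=
  padic_int_of (f := fun=> 1) (fun=> erefl).

Lemma padic_int_opp_proof (x : padic_int) n :
  (- res x n = - res x n.+1 %[mod (p ^ n)%N])%Z.
Proof. by rewrite -modzNm res_coh modzNm. Qed.
Definition padic_int_opp x : padic_int := padic_int_of (padic_int_opp_proof x).

Lemma padic_int_add_proof (x y : padic_int) n :
  (res x n + res y n = res x n.+1 + res y n.+1 %[mod (p ^ n)%N])%Z.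
Proof. by rewrite -modzDm !res_coh modzDm. Qed.
Definition padic_int_add x y : padic_int :=
  padic_int_of (padic_int_add_proof x y).

Lemma padic_int_mul_proof (x y : padic_int) n :
  (res x n * res y n = res x n.+1 * res y n.+1 %[mod (p ^ n)%N])%Z.
Proof. by rewrite -modzMm !res_coh modzMm. Qed.
Definition padic_int_mul x y : padic_int :=
  padic_int_of (padic_int_mul_proof x y).

Let addA : associative padic_int_add.
Proof.
by move=> x y z; apply: padic_int_eq => n; rewrite !modz_mod modzDmr modzDml addrA.
Qed.
Let addC : commutative padic_int_add.
Proof. by move=> x y; apply: padic_int_eq => n; rewrite !modz_mod addrC. Qed.
Let add0 : left_id padic_int0 padic_int_add.
Proof. by move=> x; apply: padic_int_eq => n; rewrite !modz_mod modzDml add0r. Qed.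
Let addN : left_inverse padic_int0 padic_int_opp padic_int_add.
Proof. by move=> x; apply: padic_int_eq => n; rewrite !modz_mod modzDml addNr. Qed.

HB.instance Definition _ := GRing.isZmodule.Build padic_int addA addC add0 addN.

Let mulA : associative padic_int_mul.
Proof.
by move=> x y z; apply: padic_int_eq => n; rewrite !modz_mod modzMmr modzMml mulrA.
Qed.
Let mulC : commutative padic_int_mul.
Proof. by move=> x y; apply: padic_int_eq => n; rewrite !modz_mod mulrC. Qed.
Let mul1 : left_id padic_int1 padic_int_mul.
Proof. by move=> x; apply: padic_int_eq => n; rewrite !modz_mod modzMml mul1r. Qed.
Let mulD : left_distributive padic_int_mul padic_int_add.
Proof.
move=> x y z; apply: padic_int_eq => n.
by rewrite !modz_mod modzMml modzDm mulrDl.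
Qed.
Let one_neq0 : padic_int1 != 0 :> padic_int.
Proof.
apply/eqP => /(congr1 (res ^~ 1%N)) /=.
by rewrite expn1 mod0z modz_small // ltz_nat prime_gt1.
Qed.

HB.instance Definition _ :=
  GRing.Zmodule_isComNzRing.Build padic_int mulA mulC mul1 mulD one_neq0.

Lemma res0 n : res 0 n = 0. Proof. by rewrite /= mod0z. Qed.
Lemma resD x y n : res (x + y) n = ((res x n + res y n) %% (p ^ n)%N)%Z.
Proof. by []. Qed.
Lemma resM x y n : res (x * y) n = ((res x n * res y n) %% (p ^ n)%N)%Z.
Proof. by []. Qed.
Lemma resN x n : res (- x) n = ((- res x n) %% (p ^ n)%N)%Z.
Proof. by []. Qed.
Lemma res_nat k n : res k%:R n = (k%:Z %% (p ^ n)%N)%Z.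
Proof.
elim: k => [|k IH]; first by rewrite res0 mod0z.
by rewrite -addn1 natrD resD IH PoszD /= modzDm.
Qed.

Lemma res_int k n : res k%:~R n = (k %% (p ^ n)%N)%Z.
Proof.
case: k => k; first by rewrite -pmulrn res_nat.
by rewrite NegzE mulrNz -pmulrn resN res_nat modzNm.
Qed.

Definition padic_int_unit : {pred padic_int} := fun x => `[< exists y, y * x = 1 >].

Definition padic_int_inv (x : padic_int) : padic_int :=
  if pselect (exists y, y * x = 1) is left e then projT1 (cid e) else x.

Let mulV : {in padic_int_unit, left_inverse 1 padic_int_inv *%R}.
Proof.
move=> x /asboolP h; rewrite /padic_int_inv; case: pselect => // e.
exact: projT2 (cid e).
Qed.
Let unitPl x y : y * x = 1 -> padic_int_unit x.
Proof. by move=> e; apply/asboolP; exists y. Qed.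
Let inv_out : {in [predC padic_int_unit], padic_int_inv =1 id}.
Proof.
by move=> x /asboolP h; rewrite /padic_int_inv; case: pselect.
Qed.

HB.instance Definition _ :=
  GRing.ComNzRing_hasMulInverse.Build padic_int mulV unitPl inv_out.

(* The valuation of Z_p: the largest n with x = 0 mod p^n.                    *)
Definition ord_int (x : padic_int) : \bar int :=
  if pselect (exists n, res x n.+1 != 0) is left e then (ex_minn e)%:Z%:E
  else +oo%E.

Lemma ord_int0 : ord_int 0 = +oo%E.
Proof. by rewrite /ord_int; case: pselect => // e; have [n] := e; rewrite res0 eqxx. Qed.

Lemma res_eq0 (x : padic_int) m n :
  (m <= n)%N -> (res x m == 0) = ((p ^ m)%N %| res x n)%Z.
Proof. by move=> mn; rewrite (res_modz x mn); apply/eqP/dvdz_mod0P. Qed.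

Lemma ord_intP (x : padic_int) : x != 0 ->
  exists n : nat, [/\ ord_int x = n%:Z%:E, res x n = 0 & res x n.+1 != 0].
Proof.
move=> x0; rewrite /ord_int; case: pselect => [e|ne]; last first.
  case/eqP: x0; apply: padic_int_eq => -[|n].
    by rewrite !modz1.
  by rewrite res0; case: (eqVneq (res x n.+1) 0) => [->//|h]; case: ne; exists n.
case: ex_minnP => n h1 h2; exists n; split=> //.
case: n h1 h2 => [|n] h1 h2; first by rewrite -res_mod modz1.
by apply/eqP/negP => /negP/h2; rewrite ltnn.
Qed.

Lemma mul_ord_int_proof (x y : padic_int) : x != 0 -> y != 0 ->
  exists m n : nat, [/\ ord_int x = m%:Z%:E, ord_int y = n%:Z%:E,
    res (x * y) (m + n) = 0 & res (x * y) (m + n).+1 != 0].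
Proof.
move=> /ord_intP[m [ex xm xm1]] /ord_intP[n [ey yn yn1]].
exists m, n; split=> //.
  apply/eqP; rewrite resM; apply/eqP/dvdz_mod0P; rewrite expnD PoszM.
  by apply: dvdz_mul; rewrite -res_eq0 ?leq_addr ?leq_addl // ?xm ?yn.
rewrite resM; apply/negP => /eqP/dvdz_mod0P.
rewrite (@res_eq0 x _ (m + n).+1) ?ltnS ?leq_addr // in xm1.
rewrite (@res_eq0 y _ (m + n).+1) ?ltnS ?leq_addl // in yn1.
move: xm1 yn1; rewrite !dvdzE abszM /=.
case: (posnP `|res x (m + n).+1|%N) => [->|X0]; first by rewrite dvdn0.
case: (posnP `|res y (m + n).+1|%N) => [->|Y0]; first by rewrite dvdn0.
rewrite !pfactor_dvdn ?muln_gt0 ?X0 // -!leqNgt lognM // => a b c.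
by have := leq_trans c (leq_add a b); rewrite ltnn.
Qed.

Let mulf_eq0 : forall x y : padic_int, x * y = 0 -> (x == 0) || (y == 0).
Proof.
move=> x y xy; case: (eqVneq x 0) => //= x0; case: (eqVneq y 0) => //= y0.
have [m [n [_ _ _]]] := mul_ord_int_proof x0 y0.
by rewrite xy res0 eqxx.
Qed.

HB.instance Definition _ := GRing.ComUnitRing_isIntegral.Build padic_int mulf_eq0.

Lemma le_ord_int (x : padic_int) (m : nat) : (m%:Z%:E <= ord_int x)%E = (res x m == 0).
Proof.
have [->|x0] := eqVneq x 0; first by rewrite ord_int0 leey res0 eqxx.
have [n [-> xn xn1]] := ord_intP x0; rewrite lee_fin lez_nat.
apply/idP/idP => [mn|/eqP xm]; first by rewrite (res_modz x mn) xn mod0z.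
by rewrite leqNgt; apply: contra xn1 => mn; rewrite (res_modz x mn) xm mod0z.
Qed.

Lemma ord_intE (x : padic_int) (n : nat) :
  res x n = 0 -> res x n.+1 != 0 -> ord_int x = n%:Z%:E.
Proof.
move=> xn xn1; apply/eqP; rewrite eq_le le_ord_int xn eqxx andbT.
have x0 : x != 0 by apply: contra xn1 => /eqP ->; rewrite res0.
have [k [ek _ _]] := ord_intP x0; rewrite ek lee_fin lez_nat leqNgt.
by apply: contra xn1; rewrite -le_ord_int ek lee_fin lez_nat.
Qed.

Lemma ord_int1 : ord_int (1 : padic_int) = 0%:Z%:E.
Proof.
  apply: ord_intE; first by rewrite -res_mod modz1.
  by rewrite (res_nat 1 1) expn1 modz_small // ltz_nat prime_gt1.
Qed.

Lemma ord_intM (x y : padic_int) : ord_int (x * y) = (ord_int x + ord_int y)%E.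
Proof.
have [->|x0] := eqVneq x 0.
  rewrite mul0r ord_int0; have [->|y0] := eqVneq y 0; first by rewrite ord_int0.
  by have [n [-> _ _]] := ord_intP y0.
have [->|y0] := eqVneq y 0.
  by rewrite mulr0 ord_int0; have [n [-> _ _]] := ord_intP x0.
have [m [n [-> -> h1 h2]]] := mul_ord_int_proof x0 y0.
by rewrite (ord_intE h1 h2) -EFinD -PoszD.
Qed.

Lemma le_ord_intD (x y : padic_int) (m : int) :
  (m%:E <= ord_int x -> m%:E <= ord_int y -> m%:E <= ord_int (x + y)%R)%E.
Proof.
case: m => m; first by rewrite !le_ord_int resD => /eqP -> /eqP ->; rewrite addr0 mod0z.
move=> _ _; apply: (@le_trans _ _ 0%:Z%:E); first by rewrite lee_fin.
by rewrite le_ord_int -res_mod modz1.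
Qed.

End PadicIntegers.

Notation padic pp := {fraction (padic_int pp)}.

Section PadicValuation.
Variables (p : nat) (pp : prime p).
Local Notation Qp := (padic pp).
Local Notation "x %:F" := (FracField.tofrac x : Qp).
Local Open Scope ereal_scope.

(* v_p (a / b) = v_p a - v_p b; independent of the chosen fraction by         *)
(* [vp_frac].                                                                 *)
Definition vp (q : Qp) : \bar int :=
  ord_int (frac (repr q)).1 - ord_int (frac (repr q)).2.


Local Open Scope ring_scope.

Let frac_repr (q : Qp) : q = (frac (repr q)).1%:F / (frac (repr q)).2%:F.
Proof.
have b0 := denom_ratioP (repr q); rewrite -[q in LHS]reprK -{1}(Ratio_numden (repr q)).
move: (frac (repr q)).1 (frac (repr q)).2 b0 => a b b0 {q}; unlock FracField.tofrac.
rewrite -[X in _ = _ * X]FracField.pi_inv -[RHS]FracField.pi_mul.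
rewrite /FracField.mulf /FracField.invf !numden_Ratio ?oner_neq0 //.
by rewrite mulr1 mul1r.
Qed.

Lemma vp_frac (x y : padic_int pp) :
  y != 0 -> vp (x%:F / y%:F) = (ord_int x - ord_int y)%E.
Proof.
move=> y0; rewrite /vp; have := frac_repr (x%:F / y%:F).
have b0 := denom_ratioP (repr (x%:F / y%:F)); move: b0.
move: (frac (repr _)).1 (frac (repr _)).2 => a b b0 /eqP.
rewrite eqr_div ?tofrac_eq0 // -!tofracM tofrac_eq => /eqP/(congr1 (@ord_int _ _)).
rewrite !ord_intM.
have [m [-> _ _]] := ord_intP b0; have [n [-> _ _]] := ord_intP y0.
case: (ord_int x) => [k| |]; case: (ord_int a) => [l| |] //=; rewrite -?EFinD // => -[e].
by congr EFin; apply/eqP; rewrite subr_eq addrAC eq_sym subr_eq addrC -e addrC.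
Qed.

Let fracP (q : Qp) : exists x y, y != 0 /\ q = x%:F / y%:F.
Proof.
exists (frac (repr q)).1, (frac (repr q)).2.
by split; [exact: denom_ratioP | exact: frac_repr].
Qed.

Lemma vp0 : vp 0 = +oo%E.
Proof.
rewrite -(mul0r 1^-1) -tofrac0 -tofrac1 vp_frac ?oner_eq0 // ord_int0.
by have [n [-> _ _]] := ord_intP (oner_neq0 (padic_int pp)).
Qed.

Lemma vp_fin (q : Qp) : q != 0 -> vp q \is a fin_num.
Proof.
have [x [y [y0 ->]]] := fracP q; rewrite mulf_eq0 negb_or tofrac_eq0 => /andP[x0 _].
rewrite vp_frac //.
by have [m [-> _ _]] := ord_intP x0; have [n [-> _ _]] := ord_intP y0.
Qed.

Lemma vpM (q r : Qp) : vp (q * r) = (vp q + vp r)%E.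
Proof.
have [x [y [y0 ->]]] := fracP q; have [z [t [t0 ->]]] := fracP r.
rewrite mulf_div -!tofracM !vp_frac ?mulf_neq0 // !ord_intM.
have [m [-> _ _]] := ord_intP y0; have [n [-> _ _]] := ord_intP t0.
by case: (ord_int x) => [k| |]; case: (ord_int z) => [l| |] //=;
   rewrite -?EFinD // opprD addrACA.
Qed.

Lemma le_vpD (q r : Qp) (m : \bar int) :
  (m <= vp q -> m <= vp r -> m <= vp (q + r)%R)%E.
Proof.
have [->|q0] := eqVneq q 0; first by rewrite add0r.
have [->|r0] := eqVneq r 0; first by rewrite addr0.
case: m => [m||]; last by move=> _ _; rewrite leNye.
  have [x [y [y0 ->]]] := fracP q; have [z [t [t0 ->]]] := fracP r.
  rewrite addf_div ?tofrac_eq0 // -!tofracM -tofracD !vp_frac ?mulf_neq0 //.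
  rewrite ord_intM.
  have [b [eb _ _]] := ord_intP y0; have [d [ed _ _]] := ord_intP t0.
  rewrite eb ed -EFinD !leeBrDr // -!EFinD => h1 h2.
  apply: le_ord_intD; rewrite ord_intM ?eb ?ed.
    by rewrite addrA EFinD leeD2r.
  by rewrite (addrC b%:Z) addrA EFinD leeD2r.
by rewrite !leye_eq => /eqP e; have := vp_fin q0; rewrite e.
Qed.

Lemma vp_int_ge1 (c : int) : (1%:Z%:E <= vp c%:~R)%E = (p %| c)%Z.
Proof.
have -> : c%:~R = (c%:~R)%:F / 1%:F :> Qp by rewrite tofrac1 divr1 rmorph_int.
rewrite vp_frac ?oner_eq0 // ord_int1 sube0 le_ord_int res_int expn1.
by apply/eqP/dvdz_mod0P.
Qed.

Lemma vp_int_ge0 (c : int) : (0%:Z%:E <= vp c%:~R)%E.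
Proof.
have -> : c%:~R = (c%:~R)%:F / 1%:F :> Qp by rewrite tofrac1 divr1 rmorph_int.
by rewrite vp_frac ?oner_eq0 // ord_int1 sube0 le_ord_int -res_mod modz1.
Qed.

Lemma vp1 : vp 1 = 0%:Z%:E.
Proof.
have := vpM 1 1; rewrite mulr1; have := vp_fin (oner_neq0 Qp).
by case: (vp 1) => // k _ [] /eqP; rewrite -subr_eq subrr eq_sym => /eqP ->.
Qed.

Lemma vpN q : vp (- q) = vp q.
Proof.
have := vpM (-1) (-1); rewrite mulrNN mulr1 vp1.
have : vp (- 1) \is a fin_num by rewrite vp_fin // oppr_eq0 oner_eq0.
rewrite -[- q]mulN1r vpM; case: (vp (-1)) => // k _ [] e.
by rewrite (_ : k = 0) ?add0e //; lia.
Qed.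

Lemma vp_p : vp p%:R = 1%:Z%:E.
Proof.
have -> : p%:R = (p%:R)%:F / 1%:F :> Qp by rewrite tofrac1 divr1 rmorph_nat.
have p1 := prime_gt1 pp; have := prime_gt0 pp => p0.
rewrite vp_frac ?oner_eq0 // ord_int1 sube0; apply: ord_intE; rewrite res_nat.
  by rewrite expn1 modzz.
have p2 : (p < p ^ 2)%N by rewrite -[X in (X < _)%N]expn1 ltn_exp2l.
by rewrite modz_small ?ltz_nat ?eqz_nat -?lt0n.
Qed.

Lemma p_neq0 : p%:R != 0 :> Qp.
Proof. by apply/eqP => e; have := vp_p; rewrite e vp0. Qed.

Lemma vp_exp (m : int) : vp (p%:R ^ m) = m%:E.
Proof.
have en (n : nat) : vp (p%:R ^+ n) = n%:Z%:E.
  by elim: n => [|n IH]; [exact: vp1 | rewrite exprS vpM IH vp_p].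
case: m => n; first exact: en.
rewrite NegzE -[p%:R ^ _]/((p%:R ^+ n.+1)^-1) .
have := vpM (p%:R ^+ n.+1)^-1 (p%:R ^+ n.+1).
rewrite mulVf ?expf_neq0 ?p_neq0 // vp1 en.
have : vp (p%:R ^+ n.+1)^-1 \is a fin_num by rewrite vp_fin // invr_eq0 expf_neq0 ?p_neq0.
by case: (vp _) => // k _ [] /eqP; rewrite eq_sym addr_eq0 => /eqP ->.
Qed.

(* Z_p / p is Z / p.                                                          *)
Lemma residue_exists (b : Qp) : (0%:Z%:E <= vp b)%E ->
  exists c : int, (1%:Z%:E <= vp (b - c%:~R)%R)%E.
Proof.
have [x [y [y0 ->]]] := fracP b; rewrite vp_frac //.
have [k [ek yk yk1]] := ord_intP y0; rewrite ek leeBrDr // -EFinD add0r le_ord_int.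
rewrite (@res_eq0 _ _ x k k.+1) // => /dvdzP[w ew].
have /dvdzP[u eu] : ((p ^ k)%N %| res y k.+1)%Z by rewrite -res_eq0 ?yk.
have cop : coprimez u p.
  rewrite coprimez_sym coprimezE prime_coprime //; apply: contra yk1 => pu.
  rewrite (@res_eq0 _ _ y k.+1 k.+1) // eu expnS PoszM.
  by apply: dvdz_mul; rewrite // dvdzE.
have /coprimezP[[s t] /= st] := cop.
exists (w * s).
have -> : x%:F / y%:F - (w * s)%:~R = (x - (w * s)%:~R * y)%:F / y%:F.
  by rewrite tofracB mulrBl tofracM mulfK ?tofrac_eq0 // rmorph_int.
rewrite vp_frac // ek leeBrDr // -EFinD (@le_ord_int _ _ _ k.+1).
rewrite resD resN resM res_int modzMml modzNm modzDmr; apply/eqP/dvdz_mod0P.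
rewrite ew eu; apply/dvdzP; exists (w * t).
rewrite expnS PoszM -[w * t * _]mulrA (mulrA t) -{1}[w]mulr1 -st; ring.
Qed.

End PadicValuation.

(* The two digit sets: {0, ..., p-1} and {-(p-1)/2, ..., (p-1)/2}.            *)
Variant digit_set := Ruban | BrowkinI.

Definition admissible (D : digit_set) (p : nat) : bool :=
  if D is BrowkinI then odd p else true.

Definition is_digit (D : digit_set) (p : nat) (c : int) : bool :=
  match D with
  | Ruban => (0 <= c <= p.-1%:Z)
  | BrowkinI => (- (p.-1./2)%:Z <= c <= (p.-1./2)%:Z)
  end.

Section Expansions.
Variables (D : digit_set) (p : nat) (pp : prime p).
Local Notation Qp := (padic pp).
Implicit Types (a b u w : Qp) (c : nat -> int).

Definition digit_sum (m : int) c (h : nat) : Qp :=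
  \sum_(i < h) (c i)%:~R * p%:R ^ (m + i%:Z).

(* Digits are numbered from the leading one: [c i] is the coefficient of      *)
(* p^(v_p(a) + i).                                                            *)
Definition is_expansion a c : Prop :=
  [/\ forall i, is_digit D p (c i), c 0 != 0 &
      forall M : int, exists H : nat, forall h : nat, (H <= h)%N ->
        (M%:E <= vp (a - digit_sum (fine (vp a)) c h)%R)%E].

(* Meaningful for a != 0 only; see [expansion_exists], [expansion_unique].    *)
Definition digits a : nat -> int := xget (fun=> 0) [set c | is_expansion a c]%classic.

Lemma digit_exists (c : int) : admissible D p ->
  exists2 d, is_digit D p d & (p %| c - d)%Z.
Proof.
have p0 := prime_gt0 pp; have pz : p%:Z != 0 by rewrite eqz_nat -lt0n.
have r0 := modz_ge0 c pz; have rp : (c %% p)%Z < p%:Z by rewrite ltz_pmod ?ltz_nat.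
have e := divz_eq c p; move: (c %/ p)%Z (c %% p)%Z e r0 rp => q r -> r0 rp.
case: D => /= [_|odp].
  exists r; [lia | by rewrite addrK dvdz_mull].
have pE : p = (2 * p.-1./2).+1 by lia.
case: (leP r (p.-1./2)%:Z) => h.
  exists r; [lia | by rewrite addrK dvdz_mull].
exists (r - p%:Z); first lia.
by apply/dvdzP; exists (q + 1); ring.
Qed.

Lemma digit_inj (c d : int) : admissible D p ->
  is_digit D p c -> is_digit D p d -> (p %| c - d)%Z -> c = d.
Proof.
move=> hD hc hd /dvdzP[q e]; have p0 := prime_gt0 pp.
have h : `|c - d| < p%:Z by case: D hD hc hd => /= *; lia.
suff q0 : q = 0 by apply/eqP; rewrite -subr_eq0 e q0 mul0r.
move: h; rewrite e normrM; nia.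
Qed.

Let digit_sumS m c h :
  digit_sum m c h.+1 = digit_sum m c h + (c h)%:~R * p%:R ^ (m + h%:Z).
Proof. by rewrite /digit_sum big_ord_recr. Qed.

Let pX m n : (p%:R ^ (m + n) = p%:R ^ m * p%:R ^ n :> Qp).
Proof. by rewrite expfzDr ?p_neq0. Qed.

Lemma expansion_exists a : admissible D p -> a != 0 -> exists c, is_expansion a c.
Proof.
move=> hD a0.
have hch b : exists c : int, is_digit D p c /\
    ((0%:Z%:E <= vp b)%E -> (1%:Z%:E <= vp (b - c%:~R)%R)%E).
  have [/residue_exists[c hc]|_] := boolP (0%:Z%:E <= vp b)%E; last first.
    by have [d hd _] := digit_exists 0 hD; exists d.
  have [d hd cd] := digit_exists c hD; exists d; split=> // _.
  have -> : b - d%:~R = (b - c%:~R) + (c - d)%:~R by rewrite rmorphB /= addrA subrK.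
  by apply: le_vpD; rewrite // vp_int_ge1.
have [ch hchP] := choice hch.
pose m := fine (vp a); have em : vp a = m%:E by rewrite fineK ?vp_fin.
pose rem := fix rem i := if i is j.+1 then (rem j - (ch (rem j))%:~R) / p%:R
                         else a * p%:R ^ (- m).
have vrem0 : vp (rem 0%N) = 0%:Z%:E by rewrite /= vpM vp_exp em -EFinD subrr.
have vrem i : (0%:Z%:E <= vp (rem i))%E.
  elim: i => [|i IH]; first by rewrite vrem0.
  rewrite [rem _]/= vpM -[p%:R^-1]/(p%:R ^ (-1)) vp_exp.
  apply: (@le_trans _ _ (1%:Z%:E + (-1)%:E)%E); first by rewrite -EFinD.
  by rewrite leeD2r //; apply: (hchP _).2.
exists (ch \o rem); split=> [i||M] /=.
- exact: (hchP _).1.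
- apply/eqP => e0; have := (hchP (rem 0%N)).2 (vrem 0%N).
  by rewrite [ch _]e0 subr0 vrem0.
have sumE h : a - digit_sum m (ch \o rem) h = p%:R ^ (m + h%:Z) * rem h.
  elim: h => [|h IH].
    by rewrite /digit_sum big_ord0 subr0 addr0 /= mulrCA -pX subrr mulr1.
  have -> : p%:R ^ (m + h.+1%:Z) = p%:R ^ (m + h%:Z) * p%:R :> Qp.
    by rewrite -addn1 PoszD addrA pX.
  rewrite digit_sumS opprD addrA IH /= -mulrA [p%:R * _]mulrC divfK ?p_neq0 //.
  by rewrite mulrBr [(ch _)%:~R * _]mulrC.
exists `|M - m|%N => h hh; rewrite -/m sumE vpM vp_exp.
apply: (@le_trans _ _ ((m + h%:Z)%:E + 0%:Z%:E)%E); last exact: leeD2l.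
by rewrite adde0 lee_fin; lia.
Qed.

Lemma expansion_unique a c c' : admissible D p ->
  is_expansion a c -> is_expansion a c' -> c = c'.
Proof.
move=> hD; pose m := fine (vp a).
have tail d h k : ((m + h%:Z)%:E <= vp (digit_sum m d (h + k) - digit_sum m d h)%R)%E.
  elim: k => [|k IH]; first by rewrite addn0 subrr vp0 leey.
  rewrite addnS digit_sumS addrAC; apply: le_vpD => //.
  rewrite vpM vp_exp.
  apply: (@le_trans _ _ (0%:Z%:E + (m + (h + k)%N%:Z)%:E)%E); last first.
    by rewrite leeD2r // vp_int_ge0.
  by rewrite add0e lee_fin; lia.
have rate d h : is_expansion a d -> ((m + h%:Z)%:E <= vp (a - digit_sum m d h)%R)%E.
  case=> _ _ /(_ (m + h%:Z))[H hH].
  have := hH (h + H)%N (leq_addl _ _); rewrite -/m => h1.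
  have := le_vpD h1 (tail d h H).
  by rewrite addrA subrK.
move=> hc hc'; apply/funext => i.
elim/ltn_ind: i => i IH; apply: digit_inj => //.
- by case: hc.
- by case: hc'.
have e : digit_sum m c i = digit_sum m c' i.
  by apply: eq_bigr => j _; rewrite IH.
have := rate _ i.+1 hc'; have := rate _ i.+1 hc.
rewrite -[vp (_ - digit_sum m c _)]vpN => h1 h2; have := le_vpD h1 h2.
rewrite !digit_sumS e opprB addrA subrK opprD.
rewrite [X in vp X]addrACA subrr add0r -mulNr -mulrDl vpM vp_exp -rmorphN -rmorphD /=.
rewrite -leeBlDr // -EFinB => h; rewrite -vp_int_ge1.
by apply: le_trans h; rewrite lee_fin; lia.
Qed.

(* For a != 0 with v_p(a) = m <= 0 the exponents m, ..., 0 are those of the   *)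
(* first |m| + 1 digits.                                                      *)
Definition floor a : Qp :=
  if (a != 0) && (vp a <= 0)%E
  then digit_sum (fine (vp a)) (digits a) `|fine (vp a)|.+1 else 0.

Fixpoint complete_quotient a (n : nat) : Qp :=
  if n is n'.+1
  then (complete_quotient a n' - floor (complete_quotient a n'))^-1 else a.

Definition partial_quotient a (n : nat) : Qp := floor (complete_quotient a n).

(* The expansion never stops at a zero denominator (recall 0^-1 = 0).         *)
Definition infinite_cf a : Prop :=
  forall n, complete_quotient a n != partial_quotient a n.

(* (u_0, w_0) = (u, w), u_(n+1) = u_n a_n + w_n, w_(n+1) = u_n.               *)
Fixpoint cf_transform (q : nat -> Qp) u w (n : nat) : Qp * Qp :=
  if n is n'.+1
  then ((cf_transform q u w n').1 * q n' + (cf_transform q u w n').2, (cf_transform q u w n').1)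
  else (u, w).

Definition same_first_digits (h : nat) a b : Prop :=
  vp a = vp b /\ forall i, (i < h)%N -> digits a i = digits b i.

(* The number of known digits of u b + w when u, w are known exactly and of b *)
(* only [floor b]: +oo stands for all digits, a value <= 0 for none.          *)
Definition known_digits u w b : \bar int :=
  if u == 0 then +oo%E else (vp u - vp (u * floor b + w)%R + 1)%E.

Definition agrees_on_known u w b N : Prop :=
  forall h : nat, (0 < h)%N -> (h%:Z%:E <= known_digits u w b)%E ->
    same_first_digits h N (u * b + w).

Definition floor_determined (x y z t b : Qp) : Prop :=
  exists f : Qp, forall N M : Qp, N != 0 -> M != 0 ->
    agrees_on_known x y b N -> agrees_on_known z t b M -> floor (N / M) = f.

End Expansions.

(* Main.v *)
Require Import Defs.
From mathcomp Require Import all_boot all_order all_algebra.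
From mathcomp Require Import zify ring.
From mathcomp Require Import fraction boolp classical_sets constructive_ereal.

(** For n >= 1 one has v(x_n) <= v(y_n) while v(a_n) = v(alpha_n) < 0, so
    v(x_(n+1)) = v(x_n) + v(alpha_n), and likewise for z_n; hence
    v(z_n) - v(x_n) does not depend on n.  With these valuations, knowing the
    known digits of N_n = x_n alpha_n + y_n means knowing it modulo
    p^(v(x_n) + 1), and a floor amounts to a class modulo p.  Varying
    numerator and denominator moves the quotient by terms of valuation at
    least v(x_n) - v(z_n) + 1 + r_n, and replacing N_n by N_n + x_n p reaches
    this bound: the floor is determined iff v(x_n) - v(z_n) + r_n >= 0. *)

Set Implicit Arguments.
Unset Strict Implicit.
Unset Printing Implicit Defensive.

Import Order.TTheory GRing.Theory Num.Theory.
Local Open Scope ring_scope.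

Lemma subf_div_expand (F : fieldType) (a b c d : F) : b != 0 -> d != 0 ->
  a / b - c / d = ((a - c) * d - c * (b - d)) / (b * d).
Proof. by move=> b0 d0; field; apply/andP. Qed.

(** One step of the algorithm: for [c] the floor of [b], the right side is the next affine form
    evaluated at the next complete quotient [(b - c)^-1], divided by that quotient. *)
Lemma affine_complete_quotient (F : fieldType) (u w b c : F) : b - c != 0 ->
  u * b + w = ((u * c + w) * (b - c)^-1 + u) / (b - c)^-1.
Proof. by move=> h; rewrite invrK mulrDl divfK //; ring. Qed.

Lemma divf_div2r (F : fieldType) (a b c : F) : c != 0 -> (a / c) / (b / c) = a / b.
Proof. by move=> c0; rewrite invf_div mulrA divfK. Qed.

(** * Valuation estimates in Q_p *)

Section Valuation.
Context {p : nat} {pp : prime p}.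
Implicit Types a b q : padic pp.

(** The residue at level [|k|] decides: since [|k| < p ^ |k|], only [k = 0] is divisible by that
    power. *)
Lemma intr_padic_eq0 (k : int) : (k%:~R == 0 :> padic pp) = (k == 0).
Proof.
apply/eqP/eqP => [|->]; last by rewrite mulr0z.
have -> : k%:~R = FracField.tofrac (k%:~R : padic_int pp) by rewrite rmorph_int.
move/eqP; rewrite tofrac_eq0 => /eqP /(congr1 (fun u => res u `|k|%N)).
rewrite res_int res0 => /dvdz_mod0P; rewrite dvdzE /= => kp.
have := ltn_expl `|k|%N (prime_gt1 pp).
by case: (posnP `|k|%N) => [|k0]; [lia | rewrite ltnNge dvdn_leq].
Qed.

Lemma ratr_padic_eq0 (x : rat) : (ratr x == 0 :> padic pp) = (x == 0).
Proof.
by rewrite /ratr mulf_eq0 invr_eq0 !intr_padic_eq0 numq_eq0 (negPf (denq_neq0 x)) orbF.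
Qed.

Lemma vpE q : q != 0 -> vp q = (fine (vp q))%:E.
Proof. by move=> q0; rewrite fineK ?vp_fin. Qed.

Lemma vp_neq0 q (m : int) : vp q = m%:E -> q != 0.
Proof. by move=> e; apply/eqP => q0; move: e; rewrite q0 vp0. Qed.

Lemma vp_eq_ge q (m : int) : vp q = m%:E -> (m%:E <= vp q)%E.
Proof. by move=> ->. Qed.

Lemma vpM_fin a b (m n : int) :
  vp a = m%:E -> vp b = n%:E -> vp (a * b) = (m + n)%:E.
Proof. by move=> ea eb; rewrite vpM ea eb. Qed.

Lemma vpV_fin q (m : int) : vp q = m%:E -> vp q^-1 = (- m)%:E.
Proof.
move=> e; have q0 := vp_neq0 e; have := vpM q^-1 q.
rewrite mulVf // vp1 e (vpE (q := q^-1)) ?invr_eq0 // => -[].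
by move: (fine _) => k h; congr EFin; lia.
Qed.

Lemma le_vpM a b (m n : int) :
  (m%:E <= vp a -> n%:E <= vp b -> (m + n)%:E <= vp (a * b)%R)%E.
Proof. by move=> ha hb; rewrite vpM EFinD; apply: leeD. Qed.

Lemma le_vpB a b (m : int) :
  (m%:E <= vp a -> m%:E <= vp b -> m%:E <= vp (a - b)%R)%E.
Proof. by move=> ha hb; apply: le_vpD; rewrite // vpN. Qed.

Lemma vpD_dominated a b (m : int) :
  vp a = m%:E -> ((m + 1)%:E <= vp b)%E -> vp (a + b) = m%:E.
Proof.
move=> ea hb; have mb : (m%:E <= vp b)%E.
  by apply: le_trans hb; rewrite lee_fin; lia.
apply/eqP; rewrite eq_le le_vpD ?ea // andbT leNgt; apply/negP => h.
have : ((m + 1)%:E <= vp (a + b)%R)%E.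
  case: (vp (a + b)) h => [k| |] //; last by rewrite leey.
  by rewrite lte_fin lee_fin; lia.
move=> /le_vpB /(_ hb); rewrite addrK ea lee_fin; lia.
Qed.

End Valuation.

(** * Digits and floors as congruences *)

Section Digits.
Context {D : digit_set} {p : nat} {pp : prime p}.
Hypothesis hD : admissible D p.
Implicit Types a b : padic pp.

Lemma digit_sumS (m : int) c h : digit_sum pp m c h.+1 =
  digit_sum pp m c h + (c h)%:~R * p%:R ^ (m + h%:Z).
Proof. by rewrite /digit_sum big_ord_recr. Qed.

Lemma eq_digit_sum (m : int) c d h : (forall i, (i < h)%N -> c i = d i) ->
  digit_sum pp m c h = digit_sum pp m d h.
Proof. by move=> e; apply: eq_bigr => i _; rewrite e. Qed.

Lemma digitsP a : a != 0 -> is_expansion D a (digits D a).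
Proof.
by move=> a0; have [c hc] := expansion_exists hD a0; apply: (xgetPex (fun=> 0)); exists c.
Qed.

(** Convergence only gives the bound from some rank [H] on; passing from [h + H] terms back to [h]
    removes terms of exponent at least [m + h]. *)
Lemma le_vp_sub_digit_sum a h : a != 0 ->
  ((fine (vp a) + h%:Z)%:E
     <= vp (a - digit_sum pp (fine (vp a)) (digits D a) h)%R)%E.
Proof.
move=> /digitsP[_ _]; move: (digits D a) (fine (vp a)) => d m.
have tail k : ((m + h%:Z)%:E <= vp (digit_sum pp m d (h + k) - digit_sum pp m d h)%R)%E.
  elim: k => [|k IH]; first by rewrite addn0 subrr vp0 leey.
  rewrite addnS digit_sumS addrAC; apply: le_vpD => //.
  rewrite [(m + _)%:E](_ : _ = (0 + (m + h%:Z))%:E); last by rewrite add0r.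
  by apply: le_vpM; [apply: vp_int_ge0 | rewrite vp_exp lee_fin; lia].
case/(_ (m + h%:Z)) => H /(_ (h + H)%N (leq_addl _ _)) h1.
by have := le_vpD h1 (tail H); rewrite addrA subrK.
Qed.

Lemma same_first_digitsP h a b : (0 < h)%N -> a != 0 -> b != 0 ->
  same_first_digits D h a b <-> ((fine (vp b) + h%:Z)%:E <= vp (a - b)%R)%E.
Proof.
move=> h0 a0 b0; split=> [[e1 e2]|hab].
  have := le_vp_sub_digit_sum h a0; have := le_vp_sub_digit_sum h b0.
  rewrite e1 (eq_digit_sum _ e2) => hb ha.
  by have := le_vpB ha hb; rewrite opprB addrA subrK.
(* Here [0 < h] matters: the difference lies strictly above the leading digit of [b]. *)
have eab : vp a = vp b.
  rewrite [in RHS]vpE // -(subrK b a) addrC.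
  apply: vpD_dominated (vpE b0) _.
  by apply: le_trans hab; rewrite lee_fin; lia.
split; first exact: eab.
move=> i; elim/ltn_ind: i => i IH ih.
have [da _ _] := digitsP a0; have [db _ _] := digitsP b0.
apply: (digit_inj pp hD) => //.
have := le_vp_sub_digit_sum i.+1 a0; have := le_vp_sub_digit_sum i.+1 b0.
rewrite eab !digit_sumS (@eq_digit_sum _ (digits D a) (digits D b)); last first.
  by move=> j ji; apply: IH => //; apply: ltn_trans ih.
move: hab; move: (fine (vp b)) (digit_sum _ _ _ _) => m s hab hb ha.
have hab' : ((m + i.+1%:Z)%:E <= vp (a - b)%R)%E.
  by apply: le_trans hab; rewrite lee_fin; lia.
(* Once the digits before [i] agree, the partial sums cancel and only the difference of the [i]-th
   digits times [p ^ (m + i)] remains; it is divisible by one more power of [p], so the two digits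
   are congruent modulo [p]. *)
have := le_vpB hab' (le_vpB ha hb).
set w := p%:R ^ _; set u := (digits D a i)%:~R; set v := (digits D b i)%:~R.
rewrite (_ : _ - _ = (u - v) * w); last by ring.
rewrite -rmorphB -vp_int_ge1 vpM vp_exp -leeBlDr // -EFinB.
by apply: le_trans; rewrite lee_fin; lia.
Qed.

Lemma le_vp_sub_floor a : (1%:E <= vp (a - floor D a)%R)%E.
Proof.
rewrite /floor; have [->|a0] /= := eqVneq a 0; first by rewrite subrr vp0 leey.
have := vpE a0; case: ifP => [hle e|/negbT hgt e]; last first.
  rewrite subr0 e; move: hgt; rewrite e -ltNge lte_fin lee_fin /=; lia.
apply: le_trans (le_vp_sub_digit_sum _ a0); move: hle; rewrite e !lee_fin /=.
lia.
Qed.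

Lemma floor_eqP a b : floor D a = floor D b <-> (1%:E <= vp (a - b)%R)%E.
Proof.
split=> [e|hab].
  have := le_vpB (le_vp_sub_floor a) (le_vp_sub_floor b).
  by rewrite e opprB addrA subrK.
have small (v : padic pp) : (1%:E <= vp v)%E -> floor D v = 0.
  by move=> hv; rewrite /floor; case: ifP => // /andP[_ /(le_trans hv)].
have [ha|ha] := leP 1%:E (vp a).
  have := le_vpB ha hab; rewrite opprB addrC subrK => hb.
  by rewrite !small.
have [hb|hb] := leP 1%:E (vp b).
  by have := le_vpD hab hb; rewrite subrK leNgt ha.
have nz (u : padic pp) : (vp u < 1%:E)%E -> u != 0.
  by apply: contraTneq => ->; rewrite vp0.
have a0 := nz _ ha; have b0 := nz _ hb.
have hb0 : fine (vp b) <= 0 by move: hb; rewrite vpE // lte_fin /=; lia.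
(* The exponents from [vp b <= 0] up to 0 number [|vp b| + 1], so a congruence modulo [p] covers
   exactly the digits that enter the floor. *)
have [|e1 e2] := (@same_first_digitsP `|fine (vp b)|.+1 _ _ isT a0 b0).2.
  by apply: le_trans hab; rewrite lee_fin; lia.
by rewrite /floor a0 b0 e1 (eq_digit_sum _ e2).
Qed.

Lemma vp_floor a (m : int) : vp a = m%:E -> m <= 0 -> vp (floor D a) = m%:E.
Proof.
move=> ea m0; rewrite (_ : floor D a = a + - (a - floor D a)); last first.
  by rewrite opprB addrC subrK.
apply: vpD_dominated => //; rewrite vpN; apply: le_trans (le_vp_sub_floor a).
by rewrite lee_fin; lia.
Qed.

(** * Determining the floor of a quotient from the known digits *)

Section Determined.
Variables (m : int) (b : padic pp).
Hypotheses (m0 : m < 0) (vb : vp b = m%:E).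

Lemma vp_affine (u w c : padic pp) (k : int) :
  vp u = k%:E -> (vp u <= vp w)%E -> vp c = m%:E -> vp (u * c + w) = (k + m)%:E.
Proof.
move=> eu; rewrite eu => hw ec; apply: vpD_dominated; first exact: vpM_fin.
by apply: le_trans hw; rewrite lee_fin; lia.
Qed.

(** The leading exponent of [u * b + w] is [k + m] and [1 - m] digits are known, so the first
    unknown exponent is [k + 1], whatever [m] is. *)
Lemma agrees_on_knownP (u w N : padic pp) (k : int) :
  vp u = k%:E -> (vp u <= vp w)%E -> N != 0 ->
  agrees_on_known D u w b N <-> ((k + 1)%:E <= vp (N - (u * b + w))%R)%E.
Proof.
move=> eu hw N0.
have e0 := vp_affine eu hw vb; have B0 := vp_neq0 e0.
have ek : known_digits D u w b = (1 - m)%:E.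
  rewrite /known_digits (negPf (vp_neq0 eu)).
  rewrite (vp_affine eu hw (vp_floor vb (ltW m0))) eu.
  by congr EFin; lia.
rewrite /agrees_on_known ek; split=> [|hN h h0].
  have -> : k + 1 = fine (vp (u * b + w)) + `|1 - m|%N%:Z by rewrite e0 /=; lia.
  by move=> H; apply/same_first_digitsP => //; [lia | apply: H; rewrite ?lee_fin; lia].
rewrite lee_fin => hm; apply/same_first_digitsP => //.
by apply: le_trans hN; rewrite e0 lee_fin /=; lia.
Qed.

Lemma floor_determinedP (x y z t : padic pp) (k l : int) :
  vp x = k%:E -> (vp x <= vp y)%E -> vp z = l%:E -> (vp z <= vp t)%E ->
  floor_determined D x y z t b <-> l - k <= - m.
Proof.
move=> ex hy ez ht.
have eN := vp_affine ex hy vb; have eM := vp_affine ez ht vb.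
set N0 := x * b + y in eN; set M0 := z * b + t in eM.
have N00 := vp_neq0 eN; have M00 := vp_neq0 eM.
split=> [[f hf]|hlk].
  have ed : vp (x * p%:R) = (k + 1)%:E by apply: vpM_fin; rewrite ?vp_p.
  have eN1 : vp (N0 + x * p%:R) = (k + m)%:E.
    by apply: vpD_dominated; rewrite // ed lee_fin; lia.
  have hM0 : agrees_on_known D z t b M0.
    by apply/(agrees_on_knownP ez ht M00); rewrite subrr vp0 leey.
  have f0 : floor D (N0 / M0) = f.
    apply: hf => //; apply/(agrees_on_knownP ex hy N00); rewrite subrr vp0 leey.
  have f1 : floor D ((N0 + x * p%:R) / M0) = f.
    have N10 := vp_neq0 eN1.
    apply: hf => //; apply/(agrees_on_knownP ex hy N10).
    by rewrite -/N0 addrAC subrr add0r ed.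
  (* The two quotients differ by [x * p / M0], of valuation [k + 1 - (l + m)]; this is at least 1
     exactly when [l - k <= - m]. *)
  have := (floor_eqP _ _).1 (etrans f1 (esym f0)).
  rewrite -mulrBl addrAC subrr add0r (vpM_fin ed (vpV_fin eM)) lee_fin.
  by clear; lia.
exists (floor D (N0 / M0)) => N M Nn0 Mn0.
move=> /(agrees_on_knownP ex hy Nn0) hN /(agrees_on_knownP ez ht Mn0) hM.
apply/floor_eqP; rewrite -/N0 -/M0 in hN hM.
(* The error on [M0] has valuation at least [l + 1], above [l + m] because [m < 0]. *)
have eM1 : vp M = (l + m)%:E.
  rewrite (_ : M = M0 + (M - M0)); last by rewrite addrC subrK.
  by apply: vpD_dominated => //; apply: le_trans hM; rewrite lee_fin; lia.
rewrite subf_div_expand ?(vp_neq0 eM1) //.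
have h1 : ((k + 1 + (l + m))%:E <= vp ((N - N0) * M0)%R)%E.
  by apply: le_vpM; rewrite // eM.
have h2 : ((k + 1 + (l + m))%:E <= vp (N0 * (M - M0))%R)%E.
  have := le_vpM (vp_eq_ge eN) hM; apply: le_trans.
  by rewrite lee_fin; clear; lia.
(* Dividing by [M * M0], of valuation [2 (l + m)], leaves at least [k + 1 - (l + m)], which [hlk]
   makes at least 1. *)
have := le_vpM (le_vpB h1 h2) (vp_eq_ge (vpV_fin (vpM_fin eM1 eM))).
by apply: le_trans; rewrite lee_fin; move: hlk; clear; lia.
Qed.

End Determined.

(** * Valuations along the continued fraction *)

Section Transform.
Context {alpha : padic pp}.
Hypothesis inf : infinite_cf D alpha.
Local Notation A := (complete_quotient D alpha).
Local Notation a := (partial_quotient D alpha).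

Lemma complete_quotient_vp n : exists2 m : int, m < 0 & vp (A n.+1) = m%:E.
Proof.
have h : A n - a n != 0 by rewrite subr_eq0 inf.
have e := vpE h; have := le_vp_sub_floor (A n).
rewrite -[floor D _]/(a n) e lee_fin => h1.
by exists (- fine (vp (A n - a n))); [lia | exact: vpV_fin].
Qed.

Lemma partial_quotient_vp n : vp (a n.+1) = vp (A n.+1).
Proof.
by have [m m0 e] := complete_quotient_vp n; rewrite e; apply: vp_floor; rewrite // ltW.
Qed.

(** * One row of the transformation, serving numerator and denominator alike *)

Section Row.
Variables u w : padic pp.
Hypotheses (uw : (u != 0) || (w != 0)) (hv : (vp (u * alpha + w)%R <= vp u)%E).
Local Notation X n := (cf_transform a u w n).1.
Local Notation Y n := (cf_transform a u w n).2.

(** This is where [hv] enters: [X 1] differs from [u * alpha + w] by [u * (alpha - a 0)], of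
    valuation at least [vp u + 1], so both have the same valuation, at most that of [Y 1 = u]. For
    [u = 0] the latter is infinite. *)
Lemma cf_transform_vp1 : exists2 k : int, vp (X 1%N) = k%:E & (vp (X 1%N) <= vp (Y 1%N))%E.
Proof.
have X1E : X 1%N = u * alpha + w - u * (alpha - floor D alpha).
  by rewrite /= /partial_quotient /=; ring.
have [u0|u0] := eqVneq u 0.
  move: uw; rewrite u0 eqxx => /= w0; exists (fine (vp w)); last by rewrite vp0 leey.
  by rewrite mul0r add0r vpE.
have c0 : u * alpha + w != 0.
  by apply: contraTneq hv => ->; rewrite vp0 vpE // -ltNge ltry.
have e : vp (X 1%N) = (fine (vp (u * alpha + w)))%:E.
  rewrite X1E; apply: vpD_dominated; rewrite ?vpN //; first exact: vpE.
  have := le_vpM (vp_eq_ge (vpE u0)) (le_vp_sub_floor alpha).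
  by apply: le_trans; move: hv; rewrite (vpE c0) (vpE u0) !lee_fin /=; clear; lia.
by exists (fine (vp (u * alpha + w))); rewrite // e -vpE.
Qed.

(** The inequality propagates because [Y n.+2 = X n.+1], while [X n.+2] gains the negative valuation
    of [a n.+1]. *)
Lemma cf_transform_le n : (vp (X n.+1) <= vp (Y n.+1))%E /\ X n.+1 != 0.
Proof.
elim: n => [|n [IH1 IH2]].
  by have [k e h] := cf_transform_vp1; split=> //; apply: vp_neq0 e.
have [m m0 e] := complete_quotient_vp n.
have eX := vp_affine m0 (vpE IH2) IH1 (etrans (partial_quotient_vp n) e).
split; last exact: vp_neq0 eX.
by rewrite [vp (X n.+2)]eX [Y n.+2]/= (vpE IH2) lee_fin /=; lia.
Qed.

Lemma cf_transform_vpS n : vp (X n.+2) = (vp (X n.+1) + vp (A n.+1))%E.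
Proof.
have [h X0] := cf_transform_le n; have [m m0 e] := complete_quotient_vp n.
rewrite e (vpE X0) -EFinD.
exact: (vp_affine m0 (vpE X0) h (etrans (partial_quotient_vp n) e)).
Qed.

Lemma cf_transform_lt n : (vp (X n.+1 * a n.+1)%R < vp (Y n.+1))%E.
Proof.
have [h X0] := cf_transform_le n; have [m m0 e] := complete_quotient_vp n.
apply: lt_le_trans h; rewrite vpM partial_quotient_vp e (vpE X0) -EFinD lte_fin; lia.
Qed.

End Row.

(** The factor [1 / A n.+1] is the same for every row, so it cancels in a quotient of two rows. *)
Lemma cf_transform_eval u w n : (cf_transform a u w n).1 * A n + (cf_transform a u w n).2 =
  ((cf_transform a u w n.+1).1 * A n.+1 + (cf_transform a u w n.+1).2) / A n.+1.
Proof.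
have h : A n - a n != 0 by rewrite subr_eq0 inf.
by rewrite {1}(affine_complete_quotient _ _ h).
Qed.

Lemma cf_transform_quotient x y z t n : (x * alpha + y) / (z * alpha + t) =
  ((cf_transform a x y n).1 * A n + (cf_transform a x y n).2) /
  ((cf_transform a z t n).1 * A n + (cf_transform a z t n).2).
Proof.
elim: n => // n ->; have [m _ /vp_neq0 A0] := complete_quotient_vp n.
rewrite (cf_transform_eval x y) (cf_transform_eval z t); exact: divf_div2r.
Qed.

Lemma cf_transform_vpB x y z t n :
  (x != 0) || (y != 0) -> (z != 0) || (t != 0) ->
  (vp (x * alpha + y)%R <= vp x)%E -> (vp (z * alpha + t)%R <= vp z)%E ->
  (vp (cf_transform a z t n.+1).1 - vp (cf_transform a x y n.+1).1 =
   vp (cf_transform a z t 1%N).1 - vp (cf_transform a x y 1%N).1)%E.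
Proof.
move=> xy zt hx hz; elim: n => // n <-.
rewrite (cf_transform_vpS xy hx) (cf_transform_vpS zt hz); have [m _ ->] := complete_quotient_vp n.
have [_ X0] := cf_transform_le xy hx n; have [_ Z0] := cf_transform_le zt hz n.
rewrite (vpE X0) (vpE Z0); congr EFin.
by move: (fine _) (fine _); clear=> k l; lia.
Qed.

End Transform.
End Digits.

Theorem proposition26 (p : nat) (pp : prime p) (D : digit_set)
    (hD : admissible D p) (alpha : padic pp) (x y z t : rat) :
  infinite_cf D alpha ->
  x * t - y * z != 0 ->
  (vp (ratr x * alpha + ratr y)%R <= vp (ratr x : padic pp))%E ->
  (vp (ratr z * alpha + ratr t)%R <= vp (ratr z : padic pp))%E ->
  let alpha_ := complete_quotient D alpha in
  let a_ := partial_quotient D alpha in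
  let x_ := fun n => (cf_transform a_ (ratr x) (ratr y) n).1 in
  let y_ := fun n => (cf_transform a_ (ratr x) (ratr y) n).2 in
  let z_ := fun n => (cf_transform a_ (ratr z) (ratr t) n).1 in
  let t_ := fun n => (cf_transform a_ (ratr z) (ratr t) n).2 in
  (forall n : nat, (1 <= n)%N ->
     (vp (x_ n * a_ n)%R < vp (y_ n))%E /\ (vp (z_ n * a_ n)%R < vp (t_ n))%E) /\
  (forall n : nat, (1 <= n)%N ->
     floor D ((ratr x * alpha + ratr y) / (ratr z * alpha + ratr t)) =
       floor D ((x_ n * alpha_ n + y_ n) / (z_ n * alpha_ n + t_ n)) /\
     (floor_determined D (x_ n) (y_ n) (z_ n) (t_ n) (alpha_ n) <->
      (vp (z_ 1%N) - vp (x_ 1%N) <= - vp (alpha_ n))%E)).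
Proof.
move=> inf det hx hz alpha_ a_ x_ y_ z_ t_.
(* A nonzero determinant excludes a zero row, which would satisfy the valuation hypothesis
   trivially. *)
have xy : (ratr x != 0 :> padic pp) || (ratr y != 0 :> padic pp).
  rewrite !ratr_padic_eq0 -negb_and; apply: contraNN det => /andP[/eqP-> /eqP->].
  by rewrite !mul0r subrr.
have zt : (ratr z != 0 :> padic pp) || (ratr t != 0 :> padic pp).
  rewrite !ratr_padic_eq0 -negb_and; apply: contraNN det => /andP[/eqP-> /eqP->].
  by rewrite !mulr0 subrr.
split=> -[//|n] _; first by split; apply: cf_transform_lt.
split; first by rewrite (cf_transform_quotient hD inf _ _ _ _ n.+1).
rewrite -(cf_transform_vpB hD inf n xy zt hx hz).
have [m m0 e] := complete_quotient_vp hD inf n.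
have [hX X0] := cf_transform_le hD inf xy hx n.
have [hZ Z0] := cf_transform_le hD inf zt hz n.
rewrite (floor_determinedP hD m0 e (vpE X0) hX (vpE Z0) hZ).
by rewrite (vpE X0) (vpE Z0) /alpha_ e -EFinB -EFinN lee_fin.
Qed.
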